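(* Let $E$ be a Banach space and let $D$ be a nonempty, bounded, weak$^\ast$-closed convex subset of $E^\ast$ with $L_D \neq \emptyset$. The set \[ NA(E^{\ast},D) := \{ x^{\ast} \in S_{E^\ast} : \langle x,x^{\ast} \rangle = 1 \text{ for some } x \in L_{D} \cap S_{E} \} \] satisfies $B_{E^{\ast}} \subseteq \overline{NA(E^{\ast},D) + \Lambda_{D}}^{\| \cdot \|}$.
   Context: Banach spaces are real. $S_E$, $S_{E^\ast}$ are the unit spheres of $E$, $E^\ast$, and $B_{E^\ast}$ is the closed unit ball of $E^\ast$. For nonempty $D \subset E^\ast$, $L_D := \{x \in E : \sup_{d^\ast\in D}\langle x,d^\ast\rangle < 0\}$, and $\Lambda_D := \{0\}\cup\{\lambda d^\ast : \lambda>0,\ d^\ast\in D\}$. $\overline{S}^{\|\cdot\|}$ denotes the norm closure of $S$ in $E^\ast$. *)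

(* Defs.v *)
From HB Require Import structures.
From mathcomp Require Import all_boot all_order all_algebra.
From mathcomp Require Import all_classical all_reals all_analysis.

Set Implicit Arguments.
Unset Strict Implicit.
Unset Printing Implicit Defensive.

Import Order.TTheory GRing.Theory Num.Theory.
Import numFieldNormedType.Exports.

Local Open Scope classical_set_scope.
Local Open Scope ring_scope.

Section dual.
Context {R : realType} (E : normedModType R).

Definition continuous_linear_form : {pred E -> R^o} :=
  fun f => `[< linear f /\ continuous f >].

Record dual : Type := Dual {
  dual_fun :> E -> R^o ;
  dual_funP : dual_fun \in continuous_linear_form }.

HB.instance Definition _ := [isSub of dual for dual_fun].
HB.instance Definition _ := [Choice of dual by <:].

Lemma continuous_linear_form_submod_closed :
  submod_closed continuous_linear_form.
Proof.
split=> [|a f g].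
  apply/asboolP; split=> [b x y|x]; last exact: cvg_cst.
  by rewrite /GRing.zero/= scaler0 addr0.
move=> /asboolP[lf cf] /asboolP[lg cg]; apply/asboolP; split=> [b x y|x].
  rewrite -[LHS]/(a *: f (b *: x + y) + g (b *: x + y)) lf lg.
  rewrite -[RHS]/(b *: (a *: f x + g x) + (a *: f y + g y)).
  by rewrite !scalerDr !scalerA (mulrC a b) addrACA.
by apply: cvgD; [apply: cvgZr; exact: cf|exact: cg].
Qed.

HB.instance Definition _ := GRing.isSubmodClosed.Build R (E -> R^o)
  continuous_linear_form continuous_linear_form_submod_closed.
HB.instance Definition _ := [SubChoice_isSubLmodule of dual by <:].

Lemma dual_linear (f : dual) : linear f.
Proof. by have /asboolP[] := dual_funP f. Qed.

Lemma dual_continuous (f : dual) : continuous f.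
Proof. by have /asboolP[] := dual_funP f. Qed.

HB.instance Definition _ (f : dual) :=
  GRing.isLinear.Build R E R^o *:%R (dual_fun f) (@dual_linear f).

Definition dual_norm (f : dual) : R :=
  sup [set `|f x| | x in [set x | `|x| <= 1]].

Lemma dual_norm_has_sup (f : dual) :
  has_sup [set `|f x| | x in [set x | `|x| <= 1]].
Proof.
split; first by exists `|f 0|, 0 => //=; rewrite normr0.
have /bounded_funP/(_ 1)[M fM] :
    bounded_near (f : {linear E -> R^o}) (nbhs (0 : E)).
  by apply/linear_bounded_continuous; exact: dual_continuous.
by exists M => _ [x /= x1 <-]; exact: fM.
Qed.

Lemma dual_norm_ub (f : dual) x : `|f x| <= dual_norm f * `|x|.
Proof.
have [->|x0] := eqVneq x 0; first by rewrite linear0 !normr0 mulr0.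
rewrite -ler_pdivrMr ?normr_gt0//.
apply: (sup_upper_bound (dual_norm_has_sup f)) => /=.
exists (`|x|^-1 *: x) => /=.
  by rewrite normrZ normfV normr_id mulVf ?normr_eq0.
by rewrite linearZ/= normrZ normfV normr_id mulrC.
Qed.

Lemma dual_normD (f g : dual) :
  dual_norm (f + g) <= dual_norm f + dual_norm g.
Proof.
apply: ge_sup; first by case: (dual_norm_has_sup (f + g)).
move=> _ [x /= x1 <-]; apply: le_trans (ler_normD _ _) _.
by apply: lerD; apply: (sup_upper_bound (dual_norm_has_sup _)); exists x.
Qed.

Lemma dual_normZ (a : R) (f : dual) : dual_norm (a *: f) = `|a| * dual_norm f.
Proof.
have le b g : dual_norm (b *: g) <= `|b| * dual_norm g.
  apply: ge_sup; first by case: (dual_norm_has_sup (b *: g)).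
  move=> _ [x /= x1 <-]; rewrite [leLHS]normrM ler_wpM2l//.
  by apply: (sup_upper_bound (dual_norm_has_sup _)); exists x.
apply/eqP; rewrite eq_le le/=.
have [->|a0] := eqVneq a 0.
  rewrite normr0 mul0r; apply: le_trans (normr_ge0 ((0 *: f : dual) 0)) _.
  apply: (sup_upper_bound (dual_norm_has_sup _)); exists 0 => //=.
  by rewrite normr0.
have := le a^-1 (a *: f).
by rewrite scalerA mulVf// scale1r normfV ler_pdivlMl ?normr_gt0.
Qed.

Lemma dual_norm0_eq0 (f : dual) : dual_norm f = 0 -> f = 0.
Proof.
move=> f0; apply/val_inj/funext => x /=.
by apply/eqP; rewrite -normr_le0 -(mul0r `|x|) -f0 dual_norm_ub.
Qed.

HB.instance Definition _ := @Lmodule_isNormed.Build R dual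
  dual_norm dual_normD dual_normZ dual_norm0_eq0.

(* The weak* topology, i.e. the topology of pointwise convergence on E. *)
Definition weak_star : topologicalType :=
  initial_topology (fun f : dual => (dual_fun f : {ptws E -> R^o})).

Definition weak_star_closed (D : set dual) : Prop :=
  closed (D : set weak_star).

Implicit Type D : set dual.

Definition L_ D : set E :=
  [set x | (ereal_sup [set (d x)%:E | d in D] < 0)%E].

Definition Lambda D : set dual :=
  [set 0] `|` [set l *: d | l in [set l : R | 0 < l] & d in D].

Definition NA D : set dual :=
  [set f : dual | `|f| = 1 /\ exists x, [/\ L_ D x, `|x| = 1 & f x = 1]].

End dual.

(* Main.v *)
From HB Require Import structures.
Require Import Defs.
From mathcomp Require Import all_boot all_order all_algebra.
From mathcomp Require Import all_classical all_reals all_analysis.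
From mathcomp Require Import ring lra.

Set Implicit Arguments.
Unset Strict Implicit.
Unset Printing Implicit Defensive.

Import Order.TTheory GRing.Theory Num.Theory.
Import numFieldNormedType.Exports.
Local Open Scope classical_set_scope.
Local Open Scope ring_scope.

(** Let s be the support function of D, a sublinear function with s <= M |.|;
    then L_ D is the open cone where s < 0. Given xs in the dual unit ball,
    consider the positively homogeneous functions

      h_l z = |z| + l s(z) - xs(z),   l >= 0.

    h_0 is nonnegative because |xs| <= 1, while h_l takes negative values for
    large l because s takes a negative value. Let l be the largest multiplier
    with h_l >= 0. Slightly above l there is a point x with h_(l+dl)(x) < 0,
    that is h_l(x) < dl (- s(x)). So s(x) < 0, and x minimizes h_l up to an
    error that is small compared with the distance, at least (- s(x)) / M, from
    x to the complement of L_ D. Ekeland's variational principle ([ekeland])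
    therefore moves x to an exact minimizer y of h_l + eps |. - y| which is
    still in L_ D ([critical_multiplier]).

    At y the subdifferential sum rule ([approx_minimizer_split]) writes xs as
    f + g + error with f in the dual unit ball, f(y) = |y|, g <= l s and
    |error| <= eps. Since s(y) < 0 the vector y is nonzero, and f lies in NA D
    with witness y / |y|. Since D is weak* closed and convex, g <= l s means
    that g is in l D when l > 0, and g = 0 when l = 0 ([le_support_Lambda]).

    Both the sum rule and the weak* separation are instances of the
    Mazur-Orlicz form of the Hahn-Banach theorem ([mazur_orlicz]), which is
    obtained from the fact that a minimal sublinear function is linear. *)

(** * Sublinear functions and the Hahn-Banach theorem *)

Definition sublinear {R : realType} {V : lmodType R} (q : V -> R) :=
  (forall x y, q (x + y) <= q x + q y) /\
  (forall t x, 0 <= t -> q (t *: x) <= t * q x).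

Lemma sublinear0 {R : realType} {V : lmodType R} (q : V -> R) :
  sublinear q -> q 0 = 0.
Proof.
move=> [qD qZ]; apply/le_anti/andP; split.
  by have := qZ 0 0 (lexx 0); rewrite scale0r mul0r.
by have := qD 0 0; rewrite addr0; lra.
Qed.

Lemma sublinear_oppr {R : realType} {V : lmodType R} (q : V -> R) x y :
  sublinear q -> q y - q (- x) <= q (x + y).
Proof.
by move=> [qD _]; have := qD (x + y) (- x); rewrite addrAC subrr add0r; lra.
Qed.

Definition convex_cone {R : realType} {V : lmodType R} (C : set V) :=
  [/\ C 0, forall a b, C a -> C b -> C (a + b) &
      forall t a, 0 <= t -> C a -> C (t *: a)].

(** The linear forms below this function are exactly the linear forms f <= q
    with c.2 <= f c.1 for all c in the cone C. *)
Definition cone_inf_conv {R : realType} {V : lmodType R} (q : V -> R)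
  (C : set (V * R^o)) (v : V) : R := inf [set q (v + c.1) - c.2 | c in C].

Section cone_inf_conv.
Context {R : realType} {V : lmodType R} {q : V -> R} {C : set (V * R^o)}.
Hypotheses (sq : sublinear q) (cC : convex_cone C).
Hypothesis Cq : forall c, C c -> c.2 <= q c.1.
Let p := cone_inf_conv q C.

Lemma cone_inf_conv_lb c v : C c -> p v <= q (v + c.1) - c.2.
Proof.
move=> Cc; apply: ge_inf; last by exists c.
exists (- q (- v)) => _ [a Ca <-].
by have := sublinear_oppr v a.1 sq; have := Cq Ca; lra.
Qed.

Lemma cone_inf_conv_ge x v :
  (forall c, C c -> x <= q (v + c.1) - c.2) -> x <= p v.
Proof.
move=> xC; apply: lb_le_inf; last by move=> _ [c Cc <-]; exact: xC.
by case: cC => C0 _ _; exists (q (v + 0) - 0), 0.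
Qed.

Lemma cone_inf_conv_le v : p v <= q v.
Proof.
case: cC => C0 _ _; have := cone_inf_conv_lb v C0.
by rewrite /= addr0 subr0.
Qed.

(** Why the convolution is useful: a linear f below it has
    - f c.1 = f (- c.1) <= - c.2. *)
Lemma cone_inf_conv_opp c : C c -> p (- c.1) <= - c.2.
Proof.
by move=> /(cone_inf_conv_lb (- c.1)); rewrite addNr sublinear0// sub0r.
Qed.

Lemma cone_inf_conv_sublinear : sublinear p.
Proof.
have [C0 CD CZ] := cC; split=> [x y|t x].
  rewrite -lerBlDr; apply: cone_inf_conv_ge => c Cc.
  rewrite lerBlDr -lerBlDl; apply: cone_inf_conv_ge => d Cd.
  rewrite lerBlDr; apply: (le_trans (cone_inf_conv_lb _ (CD _ _ Cc Cd))) => /=.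
  by have := sq.1 (x + c.1) (y + d.1); rewrite addrACA; lra.
rewrite le_eqVlt => /predU1P[<-|t0].
  rewrite scale0r mul0r; apply: le_trans (cone_inf_conv_le _) _.
  by rewrite sublinear0.
rewrite -ler_pdivrMl//; apply: cone_inf_conv_ge => c Cc.
rewrite ler_pdivrMl//.
apply: (le_trans (cone_inf_conv_lb _ (CZ _ _ (ltW t0) Cc))) => /=.
rewrite -scalerDr mulrBr -[t *: c.2]/(t * c.2) lerD2r.
exact: sq.2 (ltW t0).
Qed.

End cone_inf_conv.

(** Convolving q with the ray through (y, q y) yields a sublinear function below
    q whose value at - y is at most - q y. If q is minimal this function is q
    itself, so q is odd, and an odd sublinear function is linear. *)
Lemma minimal_sublinear_linear {R : realType} {V : lmodType R} (q : V -> R) :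
  sublinear q -> (forall p, sublinear p -> (forall x, p x <= q x) -> p = q) ->
  linear (q : V -> R^o).
Proof.
move=> sq qmin.
have qN y : q (- y) <= - q y.
  pose C : set (V * R^o) := [set (t *: y, t * q y) | t in [set t | 0 <= t]].
  have cC : convex_cone C.
    split; first by exists 0 => //=; rewrite scale0r mul0r.
      move=> _ _ [s /= s0 <-] [t /= t0 <-]; exists (s + t).
        exact: addr_ge0.
      by rewrite scalerDl mulrDl.
    move=> s _ s0 [t /= t0 <-]; exists (s * t); first exact: mulr_ge0.
    by rewrite -scalerA -mulrA.
  have Cq c : C c -> c.2 <= q c.1.
    move=> [t /= t0 <-] /=; have [->|tn0] := eqVneq t 0.
      by rewrite scale0r mul0r sublinear0.
    have tp : 0 < t by rewrite lt_neqAle eq_sym tn0.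
    rewrite -ler_pdivlMl//; have := sq.2 t^-1 (t *: y).
    by rewrite scalerA mulVf// scale1r invr_ge0; exact.
  have Cy : C (y, q y) by exists 1 => //=; rewrite scale1r mul1r.
  have := cone_inf_conv_opp sq Cq Cy.
  by rewrite (qmin _ (cone_inf_conv_sublinear sq cC Cq)
                     (cone_inf_conv_le sq cC Cq)).
have qD x y : q (x + y) = q x + q y.
  apply/le_anti; rewrite sq.1/=.
  have := sublinear_oppr x y sq; have := qN x; lra.
have qNe x : q (- x) = - q x.
  by have := qD x (- x); rewrite subrr sublinear0//; lra.
have qZ t x : 0 <= t -> q (t *: x) = t * q x.
  move=> t0; apply/le_anti; rewrite sq.2//=.
  by have := sq.2 t (- x) t0; rewrite scalerN !qNe mulrN; lra.
move=> t x y; rewrite qD; congr (_ + _).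
have [t0|t0] := leP 0 t; first exact: qZ.
by rewrite -[t]opprK scaleNr qNe qZ ?oppr_ge0 1?ltW// scaleNr.
Qed.

(** By Zorn's lemma there is a minimal sublinear function below q: the
    pointwise infimum of a chain is sublinear, and it is finite because every
    sublinear p <= q satisfies - q (- x) <= p x. *)
Lemma sublinear_minorant {R : realType} {V : lmodType R} (q : V -> R) :
  sublinear q -> exists f : {linear V -> R^o}, forall x, f x <= q x.
Proof.
move=> sq.
pose T := {p : V -> R | sublinear p /\ forall x, p x <= q x}.
pose r (a b : T) := `[< forall x, sval b x <= sval a x >].
have [||a b|A Atot|[p [sp pq]] pmin] := @Zorn T r.
- by move=> a; apply/asboolP.
- move=> a b c /asboolP ab /asboolP bc; apply/asboolP => x.
  exact: le_trans (ab x).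
- move: a b => [a ?] [b ?] /asboolP/= ab /asboolP/= ba.
  by apply/eq_exist/funext => x; apply/le_anti; rewrite ab ba.
- have [->|/set0P[a0 Aa0]] := eqVneq A set0.
    by exists (exist _ q (conj sq (fun x => lexx (q x)))).
  pose p x := inf [set sval a x | a in A].
  have p_le a x : A a -> p x <= sval a x.
    move=> Aa; apply: ge_inf; last by exists a.
    exists (- q (- x)) => _ [b _ <-]; have [/= sb bq] := svalP b.
    have := sublinear_oppr x 0 sb; rewrite sublinear0// addr0.
    by have := bq (- x); lra.
  have le_p x y : (forall a, A a -> y <= sval a x) -> y <= p x.
    move=> yA; apply: lb_le_inf; first by exists (sval a0 x), a0.
    by move=> _ [a Aa <-]; exact: yA.
  have sp : sublinear p.
    split=> [x y|t x t0].
      rewrite -lerBlDr; apply: (le_p _ _) => a Aa; rewrite lerBlDr -lerBlDl.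
      apply: (le_p _ _) => b Ab; rewrite lerBlDl.
      (* The smaller of a and b bounds p at x + y, and it lies below the other
         one at x and at y. *)
      have [/asboolP ba|/asboolP ab] := Atot _ _ Aa Ab.
        apply: (le_trans (p_le b _ Ab)); apply: le_trans ((svalP b).1.1 _ _) _.
        exact: lerD.
      apply: (le_trans (p_le a _ Aa)); apply: le_trans ((svalP a).1.1 _ _) _.
      exact: lerD.
    move: t0; rewrite le_eqVlt => /predU1P[<-|t0].
      apply: (le_trans (p_le a0 _ Aa0)).
      by rewrite scale0r mul0r sublinear0//; exact: (svalP a0).1.
    rewrite -ler_pdivrMl//; apply: (le_p _ _) => a Aa; rewrite ler_pdivrMl//.
    apply: (le_trans (p_le a _ Aa)); exact: (svalP a).1.2 (ltW t0).
  have pq x : p x <= q x by apply: le_trans (p_le _ _ Aa0) ((svalP a0).2 x).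
  exists (exist _ p (conj sp pq)) => a Aa; apply/asboolP => x /=.
  exact: p_le.
- have lp : linear (p : V -> R^o).
    apply: minimal_sublinear_linear => // p' sp' p'p.
    have p'q x : p' x <= q x by apply: le_trans (pq x).
    by have [] := pmin (exist _ p' (conj sp' p'q)) (introT (asboolP _) p'p).
  pose plin := GRing.isLinear.Build R V R^o *:%R p lp.
  by pose f : {linear V -> R^o} := HB.pack p plin; exists f.
Qed.

(** The Mazur-Orlicz theorem: linear lower bounds prescribed on a convex cone
    can be met by a linear minorant of q as soon as q itself meets them. *)
Lemma mazur_orlicz {R : realType} {V : lmodType R} (q : V -> R)
    (C : set (V * R^o)) :
  sublinear q -> convex_cone C -> (forall c, C c -> c.2 <= q c.1) ->
  exists f : {linear V -> R^o},
    (forall x, f x <= q x) /\ (forall c, C c -> c.2 <= f c.1).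
Proof.
move=> sq cC Cq.
have [f fp] := sublinear_minorant (cone_inf_conv_sublinear sq cC Cq).
exists f; split=> [x|c Cc]; first exact: le_trans (cone_inf_conv_le sq cC Cq x).
rewrite -lerN2 -[leLHS]/(- (f c.1)) -linearN.
exact: le_trans (fp _) (cone_inf_conv_opp sq Cq Cc).
Qed.

(** * Ekeland's variational principle *)

(** S x is the set of points below x for the order
    z <= x iff h z + eps |z - x| <= h x. A sequence that descends in this order,
    each time almost down to the infimum of h on the current set S, is Cauchy;
    its limit y belongs to all these sets and S y is reduced to y. *)
Lemma ekeland {R : realType} {E : completeNormedModType R} (h : E -> R)
    (m eps : R) (x0 : E) :
  continuous h -> (forall x, m <= h x) -> 0 < eps ->
  exists y, h y + eps * `|y - x0| <= h x0 /\
            forall z, h y <= h z + eps * `|z - y|.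
Proof.
move=> hc hm eps0.
pose S x := [set z | h z + eps * `|z - x| <= h x].
have Sxx x : S x x by rewrite /S /= subrr normr0 mulr0 addr0.
have S_trans x y z : S x y -> S y z -> S x z.
  rewrite /S /= => xy yz.
  have := ler_wpM2l (ltW eps0) (ler_distD y z x); lra.
have infS x z : S x z -> inf (h @` S x) <= h z.
  by move=> xz; apply: ge_inf; [exists m => _ [w _ <-]|exists z].
have next (xn : E * nat) : exists z, S xn.1 z /\
    h z <= inf (h @` S xn.1) + xn.2.+1%:R^-1.
  have [||_ [z Sz <-] hz] := @inf_adherent _ (h @` S xn.1) xn.2.+1%:R^-1.
  - by rewrite invr_gt0.
  - split; first by exists (h xn.1), xn.1.
    by exists m => _ [w _ <-].
  - by exists z; split=> //; exact: ltW.
have [nx nxP] := choice next.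
pose u := fix u n := if n is n'.+1 then nx (u n', n') else x0.
have Su n k : S (u n) (u (n + k)%N).
  elim: k => [|k IH]; first by rewrite addn0; exact: Sxx.
  by rewrite addnS; apply: S_trans IH (nxP (_, _)).1.
have near_inf n z : S (u n.+1) z -> h (u n.+1) <= h z + n.+1%:R^-1.
  move=> zS; apply: le_trans (nxP (u n, n)).2 _ => /=.
  by rewrite lerD2r; apply: infS; apply: S_trans zS; exact: (nxP (u n, n)).1.
have u_near n z : S (u n.+1) z -> `|z - u n.+1| <= eps^-1 * n.+1%:R^-1.
  move=> zS; rewrite ler_pdivlMl//; rewrite -(lerD2l (h z)).
  exact: le_trans zS (near_inf _ _ zS).
have cu : cvgn u.
  apply/cauchy_cvgP/cauchy_exP => e e0.
  have [N _ /(_ N (leqnn N)) Ne] :=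
    near_infty_natSinv_lt (PosNum (mulr_gt0 eps0 e0)).
  exists (u N.+1), N.+1 => // k /= /subnKC <-.
  rewrite -ball_normE /= distrC; apply: le_lt_trans (u_near _ _ (Su _ _)) _.
  by rewrite ltr_pdivrMl.
have Sy n : S (u n) (limn u).
  have hu : h (u k) + eps * `|u k - u n| @[k --> \oo]
            --> h (limn u) + eps * `|limn u - u n|.
    apply: cvgD; first exact: (cvg_comp _ _ cu (hc _)).
    apply: cvgMr; apply: cvg_norm; apply: cvgB => //; exact: cvg_cst.
  rewrite /S /= -(cvg_lim _ hu)//; apply: limr_le.
    by apply/cvg_ex; eexists; exact: hu.
  by exists n => // k /= /subnKC <-; exact: Su.
exists (limn u); split; first exact: (Sy 0%N).
move=> z; have [//|zy] := leP (h (limn u)) _.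
have Suz n : S (u n) z by apply: S_trans (Sy n) _; exact: ltW.
have : h (limn u) <= h z.
  apply/ler_addgt0Pr => e e0.
  have [N _ /(_ N (leqnn N)) /= Ne] := near_infty_natSinv_lt (PosNum e0).
  apply: le_trans (le_trans (near_inf _ _ (Suz N.+1)) _).
    by apply: le_trans (Sy N.+1); rewrite lerDl mulr_ge0// ltW.
  by rewrite lerD2l ltW.
have := mulr_ge0 (ltW eps0) (normr_ge0 (z - limn u)); lra.
Qed.

(** * Bounded linear forms *)

Lemma dual_norm_le {R : realType} {E : normedModType R} (f : dual E) (M : R) :
  0 <= M -> (forall x, `|f x| <= M * `|x|) -> `|f| <= M.
Proof.
move=> M0 fM; apply: ge_sup; first by case: (dual_norm_has_sup f).
move=> _ [x /= x1 <-]; apply: le_trans (fM x) _.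
by rewrite -[leRHS]mulr1 ler_wpM2l.
Qed.

Lemma dual_of_bounded {R : realType} {E : normedModType R}
    (f : {linear E -> R^o}) (M : R) :
  (forall x, `|f x| <= M * `|x|) -> exists g : dual E, dual_fun g = f.
Proof.
move=> fM; suff fc : (f : E -> R^o) \in @continuous_linear_form R E.
  by exists (Dual fc).
apply/asboolP; split; first exact: linearP.
apply/linear_bounded_continuous/bounded_funP => r; exists (`|M| * r) => x xr.
apply: le_trans (fM x) _; apply: (@le_trans _ _ (`|M| * `|x|)).
  by rewrite ler_wpM2r// ler_norm.
by rewrite ler_wpM2l.
Qed.

(** * Support functions and weak* closed convex sets *)

(** Convexity in homogeneous form, which is what makes the cone over a convex
    set closed under addition. *)
Lemma convex_set_comb {R : realType} {V : lmodType R} (D : set V)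
    (a b : V) (s t : R) :
  convex_set D -> D a -> D b -> 0 <= s -> 0 <= t -> 0 < s + t ->
  exists2 c, D c & (s + t) *: c = s *: a + t *: b.
Proof.
move=> cD Da Db s0 t0 st0.
have l0 : 0 <= s / (s + t) by rewrite divr_ge0// ltW.
have l1 : s / (s + t) <= 1 by rewrite ler_pdivrMr// mul1r lerDl.
have := cD _ _ (Itv01 l0 l1) (mem_set Da) (mem_set Db).
move=> /set_mem Dc; exists ((s / (s + t)) *: a + (1 - s / (s + t)) *: b) => //.
rewrite scalerDr !scalerA; congr (_ *: _ + _ *: _); field; exact: lt0r_neq0.
Qed.

Definition support_fun {R : realType} {E : normedModType R} (D : set (dual E))
  (x : E) : R := sup [set (d x : R) | d in D].

Section support.
Context {R : realType} {E : normedModType R} {D : set (dual E)} {M : R}.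
Hypotheses (D0 : D !=set0) (DM : forall d, D d -> `|d| <= M).

Lemma ler_dual_bounded d x : D d -> `|d x| <= M * `|x|.
Proof.
by move=> Dd; apply: le_trans (dual_norm_ub d x) _; rewrite ler_wpM2r// DM.
Qed.

Lemma support_has_ubound x : has_ubound [set (d x : R) | d in D].
Proof.
exists (M * `|x|) => _ [d Dd <-].
exact: le_trans (ler_norm _) (ler_dual_bounded _ Dd).
Qed.

Lemma le_support d x : D d -> d x <= support_fun D x.
Proof. by move=> Dd; apply: (ub_le_sup (support_has_ubound x)); exists d. Qed.

Lemma support_le x y : (forall d, D d -> d x <= y) -> support_fun D x <= y.
Proof.
move=> Dy; apply: ge_sup; last by move=> _ [d Dd <-]; exact: Dy.
by case: D0 => d Dd; exists (d x), d.
Qed.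

Lemma support_sublinear : sublinear (support_fun D).
Proof.
split=> [x y|t x t0]; apply: support_le => d Dd.
  by rewrite linearD; apply: lerD; exact: le_support.
by rewrite linearZ; apply: ler_wpM2l => //; exact: le_support.
Qed.

Lemma support_le_norm x : support_fun D x <= M * `|x|.
Proof.
apply: support_le => d Dd.
exact: le_trans (ler_norm _) (ler_dual_bounded _ Dd).
Qed.

Lemma L_support x : L_ D x <-> support_fun D x < 0.
Proof.
rewrite /L_ /= -lte_fin -ereal_sup_EFin.
- by rewrite image_comp.
- exact: support_has_ubound.
- by case: D0 => d Dd; exists (d x), d.
Qed.

End support.

(** The sets of elements of D that are e-close to g on a finite list s form the
    basis of a filter, which converges pointwise, hence weak*, to g. *)
Lemma weak_star_closed_mem {R : realType} {E : normedModType R}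
    (D : set (dual E)) (g : dual E) :
  weak_star_closed D ->
  (forall (s : seq E) (e : R), 0 < e ->
    exists2 d, D d & forall x, x \in s -> `|d x - g x| < e) ->
  D g.
Proof.
move=> cD Dg.
pose B (i : seq E * R) :=
  [set d | D d /\ forall x, x \in i.1 -> `|d x - g x| < i.2].
pose F := filter_from [set i : seq E * R | 0 < i.2] B.
have FF : ProperFilter F.
  apply: filter_from_proper; last first.
    by move=> i i0; have [d Dd dg] := Dg i.1 _ i0; exists d.
  apply: filter_from_filter; first by exists ([::], 1) => /=.
  move=> i j /= i0 j0; exists (i.1 ++ j.1, Num.min i.2 j.2) => /=.
    by rewrite lt_min i0.
  move=> d [/= Dd dg]; split; split=> // x xi; have := dg x.
    by rewrite mem_cat xi lt_min => /(_ isT)/andP[].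
  by rewrite mem_cat xi orbT lt_min => /(_ isT)/andP[].
have FD : F D by exists ([::], 1) => //= d [].
suff Fg : id @ F --> (g : weak_star E) by exact: (closed_cvg _ cD FD _ Fg).
have Fp : (fun d : dual E => (dual_fun d : {ptws E -> R^o})) @ F -->
          (dual_fun g : {ptws E -> R^o}).
  apply/pointwise_cvgP => x; apply/cvgrPdist_lt => e e0.
  exists ([:: x], e) => //= d [_ /(_ x)]; rewrite mem_head distrC; exact.
move=> A; rewrite nbhsE => -[B1 [[U oU <-] Ug] UA].
by change (F A); apply: filterS UA _; apply: Fp; exact: open_nbhs_nbhs.
Qed.

(** The bipolar argument. If g is not in D, then a finite list s keeps the image
    of D in a finite-dimensional space, centred at that of g, away from 0. A
    linear form on that space which is at least e on this image exists by
    Mazur-Orlicz; its coefficients combine the points of s into a vector z with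
    d z - g z >= e for all d in D, so g exceeds the support function at - z. *)
Lemma weak_star_closed_convex_mem {R : realType} {E : normedModType R}
    (D : set (dual E)) (M : R) (g : dual E) :
  D !=set0 -> (forall d, D d -> `|d| <= M) -> weak_star_closed D ->
  convex_set D -> (forall x, g x <= support_fun D x) -> D g.
Proof.
move=> D0 DM cD vD gD; apply: weak_star_closed_mem => // s e e0.
apply: contrapT => noD.
pose n := size s.
pose ev (d : dual E) : 'rV[R]_n := \row_i (d s`_i - g s`_i).
pose q (v : 'rV[R]_n) : R := \sum_i `|v ord0 i|.
have sq : sublinear q.
  split=> [u v|t v t0]; rewrite /q.
    by rewrite -big_split; apply: ler_sum => i _; rewrite mxE ler_normD.
  rewrite mulr_sumr; apply: ler_sum => i _.
  by rewrite mxE normrM (ger0_norm t0).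
have evZ (s0 t0 : R) a b c : (s0 + t0) *: c = s0 *: a + t0 *: b ->
    (s0 + t0) *: ev c = s0 *: ev a + t0 *: ev b.
  move=> h; apply/rowP => i; rewrite !mxE.
  have : ((s0 + t0) *: c) s`_i = (s0 *: a + t0 *: b) s`_i by rewrite h.
  rewrite -[LHS]/((s0 + t0) * c s`_i) -[RHS]/(s0 * a s`_i + t0 * b s`_i) => hi.
  by rewrite mulrBr hi; ring.
have qe d : D d -> e <= q (ev d).
  move=> Dd; rewrite leNgt; apply/negP => qlt; apply: noD; exists d => // x xs.
  have xn : (index x s < n)%N by rewrite index_mem.
  apply: le_lt_trans qlt; rewrite /q (bigD1 (Ordinal xn))//= mxE/= nth_index//.
  by rewrite lerDl sumr_ge0.
pose C : set ('rV[R]_n * R^o) :=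
  [set c | exists t d, [/\ 0 <= t, D d & c = (t *: ev d, t * e)]].
have cC : convex_cone C.
  split.
  - by case: D0 => d Dd; exists 0, d; rewrite scale0r mul0r.
  - move=> _ _ [t [a [t0 Da ->]]] [t' [b [t'0 Db ->]]].
    have : 0 <= t + t' by exact: addr_ge0.
    rewrite le_eqVlt => /predU1P[/esym/eqP|tt'].
      rewrite paddr_eq0// => /andP[/eqP-> /eqP->].
      by exists 0, a; rewrite !scale0r !mul0r addr0.
    have [c Dc cE] := convex_set_comb vD Da Db t0 t'0 tt'.
    exists (t + t'), c; split=> //; first exact: addr_ge0.
    by rewrite (evZ _ _ _ _ _ cE) mulrDl.
  - move=> t _ t0 [t' [a [t'0 Da ->]]].
    exists (t * t'), a; split=> //; first exact: mulr_ge0.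
    by rewrite -scalerA -mulrA.
have Cq c : C c -> c.2 <= q c.1.
  move=> [t [d [t0 Dd ->]]] /=; have -> : q (t *: ev d) = t * q (ev d).
    rewrite /q mulr_sumr; apply: eq_bigr => i _.
    by rewrite mxE normrM (ger0_norm t0).
  by apply: ler_wpM2l => //; exact: qe.
have [f [_ fC]] := mazur_orlicz sq cC Cq.
pose z := \sum_i f (delta_mx ord0 i) *: s`_i.
have fz d : f (ev d) = d z - g z.
  rewrite {1}(row_sum_delta (ev d)) /z [LHS]linear_sum.
  rewrite [X in X - _]linear_sum [X in _ - X]linear_sum.
  rewrite -sumrB; apply: eq_bigr => i _.
  rewrite !linearZ mxE -[LHS]/((d s`_i - g s`_i) * f (delta_mx ord0 i)).
  by rewrite mulrC; exact: mulrDr.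
have : support_fun D (- z) <= g (- z) - e.
  apply: support_le => // d Dd.
  have : C (ev d, e) by exists 1, d; rewrite scale1r mul1r.
  by move/fC => /=; rewrite fz !linearN /=; lra.
by have := gD (- z); lra.
Qed.

(** Here Lambda D appears: after division by l this is the bipolar argument, and
    for l = 0 only the zero form remains, which is the apex of Lambda D. *)
Lemma le_support_Lambda {R : realType} {E : normedModType R}
    (D : set (dual E)) (M l : R) (G : {linear E -> R^o}) :
  D !=set0 -> (forall d, D d -> `|d| <= M) -> weak_star_closed D ->
  convex_set D -> 0 <= l -> (forall x, G x <= l * support_fun D x) ->
  exists2 g, Lambda D g & dual_fun g = G.
Proof.
move=> D0 DM cD vD l0 GD.
have [g gG] : exists g : dual E, dual_fun g = G.
  apply: (@dual_of_bounded _ _ _ (l * M)) => x; rewrite ler_norml.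
  have GM y : G y <= l * M * `|y|.
    apply: le_trans (GD y) _; rewrite -mulrA ler_wpM2l//.
    exact: support_le_norm D0 DM y.
  by have := GM (- x); rewrite linearN normrN GM andbT lerNl.
exists g => //; move: l0; rewrite le_eqVlt => /predU1P[l0|l0].
  left => /=; apply/val_inj/funext => x /=; rewrite gG.
  apply/le_anti; have := GD (- x); have := GD x.
  by rewrite -l0 !mul0r linearN oppr_le0 => -> ->.
right; exists l => //; exists (l^-1 *: g); last first.
  by rewrite scalerA mulfV ?scale1r// gt_eqF.
apply: (weak_star_closed_convex_mem D0 DM) => // x.
rewrite -[leLHS]/(l^-1 * g x) ler_pdivrMl// gG; exact: GD.
Qed.

(** * Approximate critical points in the cone *)

(** The sum rule for the convex function |.| + s + eps |. - y| - xs at its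
    minimizer y. Apply Mazur-Orlicz on E * E * E to
    q (u, v, w) = |u| + s v + eps |w|. The bounds on the diagonal make the three
    components of the linear form add up to xs, and the bound at (y, y, 0) makes
    the first two touch |.| and s at y. Both families generate one cone, on
    which q dominates because y is a minimizer: multiply the inequality at
    y + w / t by t if t > 0, and use h >= 0 if t = 0. *)
Lemma approx_minimizer_split {R : realType} {E : normedModType R}
    (s : E -> R) (xs : {linear E -> R^o}) (eps : R) (y : E) :
  let h z := `|z| + s z - xs z in
  sublinear s -> 0 <= eps -> (forall z, 0 <= h z) ->
  (forall z, h y <= h z + eps * `|z - y|) ->
  exists f g : {linear E -> R^o},
    [/\ forall x, f x <= `|x|, f y = `|y|, forall x, g x <= s x &
        forall x, `|xs x - (f x + g x)| <= eps * `|x|].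
Proof.
move=> h ss eps0 h0 hy.
pose q (u : E * E * E) : R := `|u.1.1| + s u.1.2 + eps * `|u.2|.
have sq : sublinear q.
  split=> [u v|t u t0]; rewrite /q /=.
    have := ler_normD u.1.1 v.1.1; have := ss.1 u.1.2 v.1.2.
    have := ler_wpM2l eps0 (ler_normD u.2 v.2); lra.
  rewrite !normrZ ger0_norm// !mulrDr lerD//; first by rewrite lerD2l ss.2.
  by rewrite mulrCA.
pose c := `|y| + s y.
pose C : set (E * E * E * R^o) := [set d | exists t w, 0 <= t /\
  d = ((w + t *: y, w + t *: y, w), xs w + t * c)].
have cC : convex_cone C.
  split.
  - by exists 0, 0; rewrite scale0r addr0 linear0 mul0r addr0.
  - move=> _ _ [t [w [t0 ->]]] [t' [w' [t'0 ->]]].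
    exists (t + t'), (w + w'); split; first exact: addr_ge0.
    have -> : w + w' + (t + t') *: y = (w + t *: y) + (w' + t' *: y).
      by rewrite scalerDl addrACA.
    have -> // : xs (w + w') + (t + t') * c = (xs w + t * c) + (xs w' + t' * c).
    by rewrite linearD mulrDl; exact: addrACA.
  - move=> t _ t0 [t' [w [t'0 ->]]].
    exists (t * t'), (t *: w); split; first exact: mulr_ge0.
    have -> : t *: w + (t * t') *: y = t *: (w + t' *: y).
      by rewrite scalerDr scalerA.
    have -> // : xs (t *: w) + t * t' * c = t * (xs w + t' * c).
    by rewrite [RHS]mulrDr mulrA; congr (_ + _); exact: linearZ.
have Cq d : C d -> d.2 <= q d.1.
  move=> [t [w [+ ->]]]; rewrite le_eqVlt => /predU1P[<-|t0]; rewrite /q /=.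
    rewrite scale0r mul0r !addr0.
    have := mulr_ge0 eps0 (normr_ge0 w); have := h0 w; rewrite /h; lra.
  have := hy (y + t^-1 *: w); rewrite -(ler_pM2l t0).
  rewrite /h linearD linearZ /= [_ *: xs w]/(_ * xs w).
  rewrite [y + _ - y]addrAC subrr add0r normrZ normfV (gtr0_norm t0).
  have -> : y + t^-1 *: w = t^-1 *: (w + t *: y).
    by rewrite scalerDr scalerA mulVf ?gt_eqF// scale1r addrC.
  rewrite normrZ normfV (gtr0_norm t0).
  have := ss.2 t^-1 (w + t *: y); rewrite invr_ge0 => /(_ (ltW t0)).
  rewrite ler_pdivlMl// => sw.
  set v := t^-1 *: _ => hv.
  have tn0 : t != 0 by rewrite gt_eqF.
  have : t * (t^-1 * `|w + t *: y| + s v - (xs y + t^-1 * xs w)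
              + eps * (t^-1 * `|w|))
         = `|w + t *: y| + t * s v - (t * xs y + xs w) + eps * `|w| by field.
  move=> E1; move: hv; rewrite E1 /c; move: sw; rewrite -/v; lra.
have [F [Fq FC]] := mazur_orlicz sq cC Cq.
pose f u := F (u, 0, 0).
pose g u := F (0, u, 0).
pose e u := F (0, 0, u).
have lf : linear (f : E -> R^o).
  move=> a u v; have a0 : a *: 0 + 0 = 0 :> E by rewrite scaler0 addr0.
  by rewrite /f -[RHS](linearP F) -[in LHS]a0.
have lg : linear (g : E -> R^o).
  move=> a u v; have a0 : a *: 0 + 0 = 0 :> E by rewrite scaler0 addr0.
  by rewrite /g -[RHS](linearP F) -[in LHS]a0.
have Fsplit u v w : F (u, v, w) = f u + g v + e w.
  have uvw : (u, v, w) = (u + 0 + 0, 0 + v + 0, 0 + 0 + w).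
    by rewrite !addr0 !add0r.
  by rewrite uvw /f /g /e -!linearD.
pose flin := GRing.isLinear.Build R E R^o *:%R f lf.
pose glin := GRing.isLinear.Build R E R^o *:%R g lg.
pose f' : {linear E -> R^o} := HB.pack f flin.
pose g' : {linear E -> R^o} := HB.pack g glin.
have fle x : f x <= `|x|.
  by have := Fq (x, 0, 0); rewrite /q /= (sublinear0 ss) normr0 mulr0 !addr0.
have gle x : g x <= s x.
  by have := Fq (0, x, 0); rewrite /q /= !normr0 mulr0 add0r addr0.
have ele x : e x <= eps * `|x|.
  by have := Fq (0, 0, x); rewrite /q /= (sublinear0 ss) normr0 !add0r.
have fge w t : 0 <= t -> xs w + t * c <= f (w + t *: y) + g (w + t *: y) + e w.
  move=> t0; rewrite -Fsplit; apply: (FC (_, _)); by exists t, w.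
have e0 : e 0 = 0 by exact: linear0.
exists f', g'; split=> //.
  have := fge 0 1 ler01; rewrite linear0 scale1r !add0r mul1r e0 addr0 /c.
  by have := fle y; have := gle y; rewrite -[f' y]/(f y); lra.
move=> x; rewrite -[f' x]/(f x) -[g' x]/(g x).
have le1 w : xs w - (f w + g w) <= e w.
  have := fge w 0 (lexx _); rewrite scale0r mul0r !addr0; lra.
rewrite ler_norml; apply/andP; split; last exact: le_trans (le1 x) (ele x).
have := le1 (- x); have := ele (- x).
have -> : f (- x) = - f x by exact: (linearN f').
have -> : g (- x) = - g x by exact: (linearN g').
by rewrite linearN normrN; lra.
Qed.

(** The multiplier l is the largest one for which h stays nonnegative. It is
    maximal, so some x satisfies h x < dl (- s x) with dl = eps / M; Ekeland's
    principle with slope eps moves x by less than (- s x) / M, and s is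
    M-Lipschitz, so s stays negative. *)
Lemma critical_multiplier {R : realType} {E : completeNormedModType R}
    (s : E -> R) (xs : dual E) (M eps : R) (x0 : E) :
  sublinear s -> 0 < M -> (forall x, s x <= M * `|x|) -> s x0 < 0 ->
  `|xs| <= 1 -> 0 < eps ->
  exists (l : R) (y : E), let h z := `|z| + l * s z - xs z in
    [/\ 0 <= l, s y < 0, forall z, 0 <= h z &
        forall z, h y <= h z + eps * `|z - y|].
Proof.
move=> ss M0 sM sx0 xs1 eps0.
have xs_le x : xs x <= `|x|.
  apply: le_trans (ler_norm _) _; apply: le_trans (dual_norm_ub xs x) _.
  by rewrite -[leRHS]mul1r ler_wpM2r.
have s_lip x y : s x <= s y + M * `|x - y|.
  have := ss.1 y (x - y); rewrite addrC subrK.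
  by have := sM (x - y); lra.
pose L := [set l | 0 <= l /\ forall x, 0 <= `|x| + l * s x - xs x].
have L0 : L 0 by split=> // x; rewrite mul0r addr0 subr_ge0.
have Lub x : s x < 0 -> ubound L ((`|x| - xs x) / - s x).
  move=> sx l [_ /(_ x)]; rewrite ler_pdivlMr ?oppr_gt0//; lra.
have Lhas : has_sup L.
  by split; [exists 0|exists ((`|x0| - xs x0) / - s x0); exact: Lub].
pose l := sup L.
have l0 : 0 <= l by exact: sup_upper_bound.
have h0 z : 0 <= `|z| + l * s z - xs z.
  have [sz|sz] := leP 0 (s z).
    by have := mulr_ge0 l0 sz; have := xs_le z; lra.
  have : l <= (`|z| - xs z) / - s z by apply: ge_sup; [exists 0|exact: Lub].
  by rewrite ler_pdivlMr ?oppr_gt0//; lra.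
pose dl := eps / M.
have dl0 : 0 < dl by exact: divr_gt0.
(* Nonnegativity at l + dl would contradict the choice of l as a supremum. *)
have [x hx] : exists x, `|x| + (l + dl) * s x - xs x < 0.
  apply: contrapT => nx; have : L (l + dl).
    split=> [|x]; first by rewrite addr_ge0// ltW.
    by rewrite leNgt; apply/negP => hx; apply: nx; exists x.
  by move=> /(sup_upper_bound Lhas); rewrite -/l; lra.
have hc : continuous (fun z => `|z| + l * s z - xs z).
  have sc : continuous s.
    move=> z; apply/cvgrPdist_le => e e0; near=> w.
    have zw : `|z - w| <= e / M.
      near: w; apply/nbhs_normP; exists (e / M); first exact: divr_gt0.
      by move=> w /= /ltW.
    rewrite ler_norml; have := s_lip z w; have := s_lip w z.
    rewrite (distrC w z); move: zw; rewrite ler_pdivlMr// => zw zw1 zw2.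
    by apply/andP; split; lra.
  move=> z; apply: cvgB; last exact: dual_continuous.
  apply: cvgD; first exact: cvg_norm.
  by apply: cvgMr; exact: sc.
have [y [yx ymin]] := ekeland x hc h0 eps0.
exists l, y; split=> //.
have := h0 y; have := s_lip y x.
have yx' : M * `|y - x| < - s x.
  rewrite -(ltr_pM2l dl0) mulrA divfK ?gt_eqF//.
  by move: yx hx; have := h0 y; lra.
by lra.
Unshelve. all: by end_near. Qed.

Theorem corollary5 (R : realType) (E : completeNormedModType R)
    (D : set (dual E)) :
  D !=set0 -> bounded_set D -> weak_star_closed D -> convex_set D ->
  L_ D !=set0 ->
  [set f : dual E | `|f| <= 1] `<=`
    closure [set f + g | f in NA D & g in Lambda D].
Proof.
move=> D0 bD cD vD [x0 Lx0] xs /= xs1.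
have [M M0 DM] : exists2 M, 0 < M & forall d, D d -> `|d| <= M.
  have [M [_ /(_ (`|M| + 1)) DM]] := bD.
  exists (`|M| + 1); first by rewrite ltr_wpDl.
  by move=> d Dd; apply: DM Dd; rewrite (le_lt_trans (ler_norm M))// ltrDl.
have ss : sublinear (support_fun D) := support_sublinear D0 DM.
have sx0 : support_fun D x0 < 0 by apply/(L_support D0 DM).
move=> A /nbhs_normP[e e0 eA].
have e20 : 0 < e / 2 by rewrite divr_gt0.
have [l [y [l0 sy h0 hy]]] :=
  critical_multiplier ss M0 (support_le_norm D0 DM) sx0 xs1 e20.
have sls : sublinear (fun x => l * support_fun D x).
  split=> [u v|t u t0]; first by rewrite -mulrDr ler_wpM2l// ss.1.
  by rewrite mulrCA ler_wpM2l// ss.2.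
have [f [g [f1 fy gs fge]]] := approx_minimizer_split sls (ltW e20) h0 hy.
have [gd Lg gdE] := le_support_Lambda D0 DM cD vD l0 gs.
have fn x : `|f x| <= 1 * `|x|.
  rewrite mul1r ler_norml f1 andbT lerNl.
  by have := f1 (- x); rewrite linearN normrN.
have [fd fdE] := dual_of_bounded fn.
have y0 : 0 < `|y|.
  rewrite normr_gt0; apply/eqP => y0; move: sy.
  by rewrite y0 sublinear0// ltxx.
have ny : `| `|y|^-1 *: y| = 1.
  by rewrite normrZ normfV normr_id mulVf// gt_eqF.
have fny : fd (`|y|^-1 *: y) = 1.
  by rewrite fdE linearZ fy; exact: mulVf (lt0r_neq0 y0).
exists (fd + gd); split.
  exists fd; last by exists gd.
  split; last exists (`|y|^-1 *: y).
    apply/le_anti/andP; split.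
      by apply: dual_norm_le => // x; rewrite fdE.
    by have := dual_norm_ub fd (`|y|^-1 *: y); rewrite fny ny mulr1 normr1.
  split=> //; apply/(L_support D0 DM); apply: le_lt_trans (ss.2 _ _ _) _.
    by rewrite invr_ge0.
  by rewrite pmulr_rlt0// invr_gt0.
apply: eA => /=; apply: (@le_lt_trans _ _ (e / 2)); last by lra.
apply: dual_norm_le => [|x]; first exact: ltW.
by have := fge x; rewrite -fdE -gdE.
Qed.
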